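(* There exists a $\mathbf{\Sigma}^1_1$-complete set in the class $\mathbf{r}\text{-}\mathbf{BCL}(4)_\omega$.
   Context: **Blind counter automata.** For $k\ge 1$, a real time $k$-blind-counter machine is $\mathcal M=(K,\Sigma,\Delta,q_0)$ with $K$ a finite set of states, $\Sigma$ a finite alphabet, $q_0\in K$, and $\Delta\subseteq K\times\Sigma\times\{0,1\}^k\times K\times\{0,1,-1\}^k$, such that if $(q,a,i_1,\dots,i_k,q',j_1,\dots,j_k)\in\Delta$ and $i_m=0$ then $j_m\in\{0,1\}$, and the tuple obtained by replacing $i_m=0$ by $i_m=1$ (all other entries unchanged) is also in $\Delta$. Configurations are tuples $(q,c_1,\dots,c_k)$ with $q\in K$, $c_i\in\mathbb N$. Write $a:(q,c_1,\dots,c_k)\mapsto_{\mathcal M}(q',c_1+j_1,\dots,c_k+j_k)$ if $(q,a,i_1,\dots,i_k,q',j_1,\dots,j_k)\in\Delta$ where $i_m=0$ if $c_m=0$ and $i_m=1$ if $c_m>0$. A run on $\sigma=a_1a_2\cdots\in\Sigma^\omega$ is an infinite sequence of configurations $(r_i)_{i\ge1}$ with $r_1=(q_0,0,\dots,0)$ and $a_i:r_i\mapsto_{\mathcal M}r_{i+1}$ for all $i\ge1$. A (non-deterministic) real time Büchi $k$-blind-counter automaton is such a machine together with a set $F\subseteq K$; it accepts the set of $\sigma\in\Sigma^\omega$ having a run in which some state of $F$ occurs infinitely often. $\mathbf{r}\text{-}\mathbf{BCL}(k)_\omega$ is the class of $\omega$-languages, over finite alphabets, accepted by these automata. **Topology.**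 $\Sigma^\omega$ carries the Cantor (product) topology; (boldface) $\mathbf\Sigma^1_1$ is the class of analytic sets (projections of Borel sets). A set $F\subseteq\Sigma^\omega$ is $\mathbf\Sigma^1_1$-complete iff for every finite alphabet $Y$ and every $E\subseteq Y^\omega$: $E\in\mathbf\Sigma^1_1$ iff there is a continuous $f:Y^\omega\to\Sigma^\omega$ with $E=f^{-1}(F)$. *)

(* Defs.v *)
From mathcomp Require Import all_boot all_order all_algebra.
From mathcomp Require Import all_classical topology measure.

Set Implicit Arguments.
Unset Strict Implicit.
Unset Printing Implicit Defensive.

Import GRing.Theory.

Local Open Scope classical_set_scope.

Definition omega_words (A : finType) : topologicalType :=
  {ptws nat -> discrete_topology A}.

(* In [bc_trans q a i q' j], [i m] is the bit telling whether counter [m] is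
   positive, and [j m] is the increment of counter [m]. *)
Record bc_machine (k : nat) (A : finType) := BCMachine {
  bc_state : finType;
  bc_init : bc_state;
  bc_trans : bc_state -> A -> {ffun 'I_k -> bool} ->
             bc_state -> {ffun 'I_k -> int} -> bool;
  bc_trans_incr : forall q a i q' j, bc_trans q a i q' j ->
    forall m, j m \in [:: 0; 1; -1]%R;
  bc_trans_zero : forall q a i q' j, bc_trans q a i q' j ->
    forall m, i m = false -> j m \in [:: 0; 1]%R;
  (* Blindness: a transition enabled on a zero counter is also enabled when
     that counter is positive. *)
  bc_trans_blind : forall q a i q' j, bc_trans q a i q' j ->
    forall m, i m = false ->
    bc_trans q a [ffun n => if n == m then true else i n] q' j
}.

Section Runs.
Variables (k : nat) (A : finType) (M : bc_machine k A).

Definition bc_config : Type := (bc_state M * {ffun 'I_k -> nat})%type.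

Definition bc_step (a : A) (r r' : bc_config) : Prop :=
  exists j : {ffun 'I_k -> int},
    bc_trans r.1 a [ffun m => (0 < r.2 m)%N] r'.1 j /\
    forall m, ((r'.2 m)%:Z = (r.2 m)%:Z + j m)%R.

Definition bc_run (s : omega_words A) (r : nat -> bc_config) : Prop :=
  r 0%N = (bc_init M, [ffun=> 0%N]) /\
  forall n, bc_step (s n) (r n) (r n.+1).

End Runs.

Record buchi_bc_automaton (k : nat) (A : finType) := BuchiBCAutomaton {
  buchi_machine :> bc_machine k A;
  buchi_final : {set bc_state buchi_machine}
}.

Definition buchi_language (k : nat) (A : finType)
    (M : buchi_bc_automaton k A) : set (omega_words A) :=
  [set s | exists2 r : nat -> bc_config M, bc_run s r &
    exists2 q, q \in buchi_final M &
      forall n, exists2 p, (n <= p)%N & (r p).1 = q].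

Definition rBCL_omega (k : nat) (A : finType) : set (set (omega_words A)) :=
  [set L | exists M : buchi_bc_automaton k A, L = buchi_language M].

Definition Borel (T : topologicalType) : set (set T) := <<s open >>.

Definition Sigma11 (Y : finType) : set (set (omega_words Y)) :=
  [set E | exists (Z : finType) (B : set (omega_words Y * omega_words Z)),
     Borel B /\ E = fst @` B].

Definition Sigma11_complete (A : finType) (F : set (omega_words A)) : Prop :=
  forall (Y : finType) (E : set (omega_words Y)),
    Sigma11 E <->
    exists2 f : omega_words Y -> omega_words A, continuous f & E = f @^-1` F.

(* Main.v *)
(* The automaton.  A word codes, phase after phase, an infinite layered graph:
   the vertices of layer [n] are the naturals below [2 ^ n], each edge goes from
   some [v] to [2 v] or [2 v + 1], and phase [n] lists the edges from layer [n]
   to layer [n + 1].  In each phase the automaton guesses one edge.  It keeps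
   the current vertex [v] in one counter and [2 ^ n - 1 - v] in another, so that
   decrementing them by [u] and [2 ^ n - 1 - u] is possible only if [u = v]:
   a blind counter can only test an inequality, but the two together test an
   equality.  It thus accepts iff the graph has an infinite path from the root
   taking infinitely many edges [v -> 2 v + 1].

   Hardness.  An analytic set is a projection along Baire space of a closed set.
   Coding points of Baire space by binary sequences with infinitely many ones,
   the prefixes that still extend to a witness for a word sharing a given prefix
   with [x] form such a graph, whose first layers depend only on finitely many
   letters of [x]; [x] is in the set iff there is a path as above.

   Conversely, runs are coded by words over a finite alphabet, for which being
   an accepting run is a G-delta condition. *)

Require Import Defs.
From mathcomp Require Import all_boot all_order all_algebra.
From mathcomp Require Import all_classical topology measure.
From mathcomp Require Import zify.

Set Implicit Arguments.
Unset Strict Implicit.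
Unset Printing Implicit Defensive.

Local Open Scope classical_set_scope.

(** * Prefix topology and the Souslin normal form *)

Definition agree (X : Type) (m : nat) (x y : nat -> X) : Prop :=
  forall i, (i < m)%N -> x i = y i.

Definition agree2 (X Y : Type) (m : nat) (p q : (nat -> X) * (nat -> Y)) :=
  agree m p.1 q.1 /\ agree m p.2 q.2.

Lemma agree_le (X : Type) (m n : nat) (x y : nat -> X) :
  (m <= n)%N -> agree n x y -> agree m x y.
Proof. by move=> mn xy i im; apply: xy; apply: leq_trans mn. Qed.

Lemma nbhs_omega (A : finType) (x : omega_words A) (S : set (omega_words A)) :
  nbhs x S <-> exists m, forall y : omega_words A, agree m x y -> S y.
Proof.
split.
(* The filter generated by the cylinders around [x] converges to [x] coordinatewise, hence in the
   product topology. *)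
- pose F := [set S : set (omega_words A) |
    exists m, forall y : omega_words A, agree m x y -> S y].
  have FF : Filter F.
    split; first by exists 0%N.
    - move=> P Q [m Pm] [n Qn]; exists (maxn m n) => y xy.
      split; [apply: Pm|apply: Qn]; apply: agree_le xy;
        [exact: leq_maxl|exact: leq_maxr].
    - by move=> P Q PQ [m Pm]; exists m => y /Pm /PQ.
  have Fx : {ptws, F --> x}; last exact: (Fx S).
  apply/(@pointwise_cvgP _ _ F x FF) => t.
  apply/(@discrete_cvg (discrete_topology A)).
  by exists t.+1 => y /(_ t (ltnSn t)) /= ->.
- case=> m Sm; have : nbhs x [set y : omega_words A | agree m x y].
    elim: m {Sm} => [|m IH]; first exact: filterE.
    have xm : nbhs x [set y : omega_words A | y m = x m].
      have := @proj_continuous _ (fun=> discrete_topology A) m x.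
      by move=> /(_ [set x m]); apply; exact: discrete_set1.
    apply: filterS2 IH xm => y /= xy ym i.
    by rewrite ltnS leq_eqVlt => /predU1P[->//|/xy].
  exact: filterS.
Qed.

Lemma nbhs_omega2 (A B : finType) (p : omega_words A * omega_words B)
    (S : set (omega_words A * omega_words B)) :
  nbhs p S <-> exists m,
    forall q : omega_words A * omega_words B, agree2 m p q -> S q.
Proof.
split.
- case=> -[P Q] /= [/nbhs_omega[m Pm] /nbhs_omega[n Qn]] PQS.
  exists (maxn m n) => q [q1 q2]; apply: PQS; split.
    by apply: Pm; apply: agree_le q1; exact: leq_maxl.
  by apply: Qn; apply: agree_le q2; exact: leq_maxr.
- case=> m Sm.
  exists ([set y : omega_words A | agree m p.1 y],
          [set y : omega_words B | agree m p.2 y]) => /=.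
    by split; apply/nbhs_omega; exists m.
  by move=> q [q1 q2]; exact: Sm.
Qed.

Lemma continuous_omega (A B : finType) (f : omega_words A -> omega_words B) :
  continuous f <-> forall x m, exists n,
    forall y : omega_words A, agree n x y -> agree m (f x) (f y).
Proof.
split=> [cf x m|cf x S /nbhs_omega[m Sm]].
- have : nbhs (f x) [set y : omega_words B | agree m (f x) y].
    by apply/nbhs_omega; exists m.
  by move=> /cf /nbhs_omega.
- have [n fn] := cf x m; apply/nbhs_omega; exists n => y /fn; exact: Sm.
Qed.

Lemma open_omega2 (A B : finType) (S : set (omega_words A * omega_words B)) :
  open S <-> forall p, S p -> exists m,
    forall q : omega_words A * omega_words B, agree2 m p q -> S q.
Proof.
rewrite openE; split=> [oS p /oS|oS p /oS]; first by move=> /nbhs_omega2.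
by move=> H; apply/nbhs_omega2.
Qed.

(* The topology of [T] is given by the relations [ag m] of agreement up to [m];
   [analytic] means being a projection along Baire space of a closed set. *)
Section Analytic.
Variables (T : Type) (ag : nat -> T -> T -> Prop).
Hypothesis ag_le : forall m n p q, (m <= n)%N -> ag n p q -> ag m p q.

Definition closed_matrix (C : T -> (nat -> nat) -> Prop) : Prop :=
  forall p w, ~ C p w ->
    exists m, forall p' w', ag m p p' -> agree m w w' -> ~ C p' w'.

Definition analytic (S : set T) : Prop :=
  exists2 C, closed_matrix C & forall p, S p <-> exists w, C p w.

Lemma analytic_closed (S : set T) :
  (forall p, ~ S p -> exists m, forall q, ag m p q -> ~ S q) -> analytic S.
Proof.
move=> cS; exists (fun p _ => S p) => [p w /cS[m Sm]|p].
  by exists m => p' w' /Sm.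
by split=> [Sp|[]//]; exists id.
Qed.

(** [w 0] guesses the radius of a ball around [p] inside [S]. Points agreeing with [p] up to that
    radius have the same ball, so the matrix is even locally constant. *)
Lemma analytic_open (S : set T) :
  (forall p, S p -> exists m, forall q, ag m p q -> S q) ->
  (forall m p q r, ag m p q -> ag m p r -> ag m q r) ->
  (forall m p, ag m p p) -> analytic S.
Proof.
move=> oS ag_trans ag_refl.
exists (fun p w => forall q, ag (w 0) p q -> S q) => [p w Cpw|p].
- exists (w 0).+1 => p' w' pp' ww'; rewrite -(ww' 0) // => Cp'.
  apply: Cpw => q pq; apply: Cp'; apply: ag_trans pq.
  exact: ag_le (leqnSn _) pp'.
- split=> [/oS[m Sm]|[w Sw]]; first by exists (fun=> m).
  exact: Sw.
Qed.

Lemma analytic_choice (S : nat -> set T) :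
  (forall i, analytic (S i)) -> exists C : nat -> T -> (nat -> nat) -> Prop,
    (forall i, closed_matrix (C i)) /\
    forall i p, S i p <-> exists w, C i p w.
Proof.
move=> aS; have /choice[C CP] i : exists C, closed_matrix C /\
    forall p, S i p <-> exists w, C p w.
  by have [C] := aS i; exists C.
by exists C; split=> i; have [] := CP i.
Qed.

Lemma analytic_bigcup (S : nat -> set T) :
  (forall i, analytic (S i)) -> analytic (\bigcup_i S i).
Proof.
move=> /analytic_choice[C [cC SC]].
exists (fun p w => C (w 0) p (fun k => w k.+1)) => [p w /cC[m Cm]|p].
- exists m.+1 => p' w' pp' ww'; rewrite -(ww' 0)//; apply: Cm.
    exact: ag_le (leqnSn _) pp'.
  by move=> i im; apply: ww'.
- split=> [[i _ /SC[w Cw]]|[w Cw]].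
    by exists (fun k => if k is k'.+1 then w k' else i).
  by exists (w 0) => //; apply/SC; exists (fun k => w k.+1).
Qed.

Lemma analytic_bigcap (S : nat -> set T) :
  (forall i, analytic (S i)) -> analytic (\bigcap_i S i).
Proof.
move=> /analytic_choice[C [cC SC]].
exists (fun p w => forall i, C i p (fun k => w (pickle (i, k)))) => [p w|p].
- move=> /existsNP[i /cC[m Cm]].
  (* Agreement up to [n] covers the first [m] entries of the [i]-th witness, which [pickle] spreads
     out. *)
  pose n := maxn m (\max_(k < m) (pickle (i, val k)).+1).
  exists n => p' w' pp' ww' /(_ i); apply: Cm.
    by apply: ag_le pp'; exact: leq_maxl.
  move=> k km; apply: ww'; rewrite /n leq_max; apply/orP; right.
  exact: (@leq_bigmax _ (fun k : 'I_m => (pickle (i, val k)).+1) (Ordinal km)).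
- split=> [Sp|[w Cw] i _]; last by apply/SC; eexists; exact: Cw.
  have /choice[w Cw] i : exists w, C i p w.
    by apply/SC; exact: Sp.
  exists (fun l => if unpickle l is Some (i, k) then w i k else 0) => i.
  by under eq_fun do rewrite pickleK.
Qed.

End Analytic.

Lemma Borel_analytic (Y Z : finType) (B : set (omega_words Y * omega_words Z)) :
  Borel B -> analytic (@agree2 Y Z) B.
Proof.
have ag_le (m n : nat) (p q : (nat -> Y) * (nat -> Z)) : (m <= n)%N ->
    agree2 n p q -> agree2 m p q.
  by move=> mn [pq1 pq2]; split; apply: agree_le mn _.
(* Complements are carried along because analytic sets are not closed under complement; unions and
   intersections then trade places. *)
pose G := [set B : set (omega_words Y * omega_words Z) |
  analytic (@agree2 Y Z) B /\ analytic (@agree2 Y Z) (~` B)].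
suff : @Borel _ `<=` G by move=> + BB => /(_ _ BB)[].
apply: smallest_sub.
- split.
  + split; first by apply: analytic_closed => p _; exists 0 => q _ [].
    by rewrite setC0; apply: analytic_closed => p /(_ I).
  + by move=> S [aS aCS]; rewrite setTD; split; rewrite ?setCK.
  + move=> S GS; split; first by apply: analytic_bigcup => // i; case: (GS i).
    by rewrite setC_bigcup; apply: analytic_bigcap => // i; case: (GS i).
- move=> S /open_omega2 oS; split.
    apply: analytic_open => //.
    move=> m p q r [pq1 pq2] [pr1 pr2].
    by split=> i im; rewrite -?pq1 -?pq2 ?pr1 ?pr2.
  apply: analytic_closed => p /contrapT /oS[m Sm].
  by exists m => q /Sm Sq; apply.
Qed.

(** Each entry of the new witness pickles a letter of the projected word with an entry of the old
    witness. An undecodable sequence is detected at a single entry, so the matrix stays closed. *)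
Lemma Sigma11_baire (Y : finType) (E : set (omega_words Y)) :
  Sigma11 E -> analytic (@agree Y) E.
Proof.
case=> Z [B [/Borel_analytic[C cC BC] ->]].
pose dec (w : nat -> nat) (yz : (nat -> Z) * (nat -> nat)) :=
  forall k, unpickle (w k) = Some (yz.1 k, yz.2 k).
exists (fun x w => exists2 yz, dec w yz & C (x, yz.1) yz.2) => [x w nC|x].
- have [[yz dyz]|ndec] := pselect (exists yz, dec w yz).
    have /cC[m Cm] : ~ C (x, yz.1) yz.2 by move=> Cyz; apply: nC; exists yz.
    exists m => x' w' xx' ww' [yz' dyz' Cyz'].
    have yzE i : (i < m)%N -> yz.1 i = yz'.1 i /\ yz.2 i = yz'.2 i.
      by move=> im; move: (dyz i); rewrite ww' // dyz' => -[-> ->].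
    apply: (Cm (x', yz'.1) yz'.2) => //.
      by split=> //= i /yzE[].
    by move=> i /yzE[].
  have [k wk] : exists k, ~ exists yz : Z * nat, unpickle (w k) = Some yz.
    apply: contrapT => /forallNP wP; apply: ndec.
    have /choice[yz yzP] k : exists yz : Z * nat, unpickle (w k) = Some yz.
      exact: contrapT (wP k).
    by exists (fst \o yz, snd \o yz) => k /=; rewrite yzP; case: (yz k).
  exists k.+1 => x' w' _ ww' [yz dyz _]; apply: wk.
  by exists (yz.1 k, yz.2 k); rewrite ww'.
- split=> [[[x' y] Bxy /= <-]|[w [yz _ Cyz]]].
    have /BC[z Cz] := Bxy.
    exists (fun k => pickle (y k, z k)); exists (y, z) => // k /=.
    by rewrite pickleK.
  by exists (x, yz.1) => //; apply/BC; exists yz.2.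
Qed.

(** * Binary sequences with infinitely many ones *)

Definition infinitely_often (P : nat -> Prop) : Prop :=
  forall n, exists2 p, (n <= p)%N & P p.

Fixpoint bits_val (b : nat -> bool) (n : nat) : nat :=
  if n is k.+1 then (bits_val b k).*2 + b k else 0.

Lemma bits_val_lt (b : nat -> bool) (n : nat) : bits_val b n < 2 ^ n.
Proof. by elim: n => //= n; rewrite expnS; case: (b n); lia. Qed.

Lemma bits_val_agree (b b' : nat -> bool) (n : nat) :
  bits_val b n = bits_val b' n <-> agree n b b'.
Proof.
split; elim: n => //= n IH.
- move=> e i; have bn : b n = b' n by case: (b n) (b' n) e => [] []; lia.
  have /IH bb' : bits_val b n = bits_val b' n by rewrite bn in e; lia.
  by rewrite ltnS leq_eqVlt => /predU1P[->//|/bb'].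
- by move=> bb'; rewrite IH ?(bb' n)// => i /ltnW; exact: bb'.
Qed.

Fixpoint count_ones (b : nat -> bool) (n : nat) : nat :=
  if n is k.+1 then count_ones b k + b k else 0.

Lemma count_ones_agree (b b' : nat -> bool) (n : nat) :
  agree n b b' -> count_ones b n = count_ones b' n.
Proof.
elim: n => //= n IH bb'; rewrite (bb' n)// IH// => i /ltnW; exact: bb'.
Qed.

Lemma count_ones_le (b : nat -> bool) (m n : nat) :
  (m <= n)%N -> (count_ones b m <= count_ones b n)%N.
Proof.
by elim: n => [|n IH]; rewrite leq_eqVlt => /predU1P[->//|//] /IH /=; lia.
Qed.

Lemma count_ones_inj (b : nat -> bool) (m n : nat) :
  b m -> b n -> count_ones b m = count_ones b n -> m = n.
Proof.
move=> bm bn e; case: (ltngtP m n) => // lt.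
- by have := count_ones_le b lt; rewrite /= bm; lia.
- by have := count_ones_le b lt; rewrite /= bn; lia.
Qed.

Lemma count_ones_surj (b : nat -> bool) (n k : nat) :
  (k < count_ones b n)%N -> exists i, [/\ (i < n)%N, b i & count_ones b i = k].
Proof.
elim: n => //= n IH; case: (ltnP k (count_ones b n)) => [/IH[i [ilt bi ik]] _|].
  by exists i; split=> //; exact: ltnW.
by case: (boolP (b n)) => bn le lt; exists n; split=> //; lia.
Qed.

Lemma count_ones_unbounded (b : nat -> bool) (k : nat) :
  infinitely_often b -> exists n, (k <= count_ones b n)%N.
Proof.
move=> ib; elim: k => [|k [n kn]]; first by exists 0.
have [p np bp] := ib n; exists p.+1; rewrite /= bp.
by have := count_ones_le b np; lia.
Qed.

(* The positions of the ones of [b] code [w]: the [k]-th one sits at a position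
   of 2-adic valuation [w k]. *)
Definition codes (b : nat -> bool) (w : nat -> nat) : Prop :=
  forall n, b n -> w (count_ones b n) = logn 2 n.

Lemma codes_decode (b : nat -> bool) :
  infinitely_often b -> exists w, codes b w.
Proof.
move=> ib; have /choice[g gP] k : exists n, b n /\ count_ones b n = k.
  have [n kn] := count_ones_unbounded k.+1 ib.
  by have [i [_ bi ik]] := count_ones_surj kn; exists i.
exists (logn 2 \o g) => n bn /=; congr (logn 2 _).
by have [bg cg] := gP (count_ones b n); exact: count_ones_inj cg.
Qed.

(** Greedy coding: the next entry of [w] is written at the first remaining position of the right
    valuation. The count comes first because each bit depends on the number of ones before it. *)
Fixpoint code_count (w : nat -> nat) (n : nat) : nat :=
  if n is k.+1 then code_count w k + (w (code_count w k) == logn 2 k) else 0.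

Definition code (w : nat -> nat) (n : nat) : bool :=
  w (code_count w n) == logn 2 n.

Lemma count_ones_code (w : nat -> nat) (n : nat) :
  count_ones (code w) n = code_count w n.
Proof. by elim: n => //= n ->. Qed.

Lemma codes_code (w : nat -> nat) : codes (code w) w.
Proof. by move=> n /eqP; rewrite count_ones_code. Qed.

Lemma code_infinite (w : nat -> nat) : infinitely_often (code w).
Proof.
move=> n; apply: contrapT => nP.
have cc p : (n <= p)%N -> code_count w p = code_count w n.
  move=> /subnKC <-; elim: (p - n) => [|i IH]; first by rewrite addn0.
  rewrite addnS /= {1}IH; case: eqP => [e|]; last by rewrite addn0.
  by case: nP; exists (n + i); [lia|apply/eqP].
(* With no ones from [n] on, the awaited entry of [w] stays fixed; [p] is at least [n] and has
   exactly that valuation. *)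
apply: nP; pose p := 2 ^ w (code_count w n) * 3 ^ n.
have np : (n <= p)%N.
  apply: leq_trans (ltnW (ltn_expl n (isT : 1 < 3))) _.
  by rewrite leq_pmull// expn_gt0.
exists p => //; apply/eqP; rewrite cc// lognM ?expn_gt0// pfactorK//.
by rewrite lognX (_ : logn 2 3 = 0)// muln0 addn0.
Qed.

(** * Analytic sets through branches with infinitely many ones *)

Section BranchNormalForm.
Variables (Y : finType) (C : (nat -> Y) -> (nat -> nat) -> Prop).

(* Prefixes of witnesses of length [n] are identified with the naturals below
   [2 ^ n]; [branch_edge x n v c] says that the prefix [v] extended by the bit
   [c] still extends to a witness for some word sharing with [x] its first [n]
   letters. *)
Definition branch_edge (x : nat -> Y) (n v : nat) (c : bool) : bool :=
  `[< exists x' b w, [/\ agree n x x', bits_val b n = v, b n = c,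
                         codes b w & C x' w] >].

Lemma branch_edge_agree (x x' : nat -> Y) (n : nat) :
  agree n x x' -> branch_edge x n = branch_edge x' n.
Proof.
move=> xx'; apply/funext => v; apply/funext => c; apply/asboolP/asboolP.
- move=> -[y [b [w [xy bv bc bw Cy]]]]; exists y, b, w; split=> //.
  by move=> i lt; rewrite -xx' // xy.
- move=> -[y [b [w [xy bv bc bw Cy]]]]; exists y, b, w; split=> //.
  by move=> i lt; rewrite xx' // xy.
Qed.

(** The words and witnesses behind the edges of a branch vary with [n], but agree with [x] and the
    decoded [w] on ever longer prefixes: the ones of [b] below [n] fix that many entries of [w].
    Closedness of [C] then yields [C x w]. *)
Lemma branch_normal_form (x : nat -> Y) :
  closed_matrix (@agree Y) C ->
  (exists w, C x w) <-> exists2 b : nat -> bool, infinitely_often b &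
                          forall n, branch_edge x n (bits_val b n) (b n).
Proof.
move=> cC; split=> [[w Cw]|[b ib bP]].
- exists (code w) => [|n]; first exact: code_infinite.
  by apply/asboolP; exists x, (code w), w; split=> //; exact: codes_code.
- have [w bw] := codes_decode ib; exists w; apply: contrapT => /cC[m Cm].
  have [n mn] := count_ones_unbounded m ib.
  have /asboolP[x' [b' [w' [xx' bv _ bw' Cw']]]] := bP (maxn m n).
  have /bits_val_agree bb' := esym bv.
  apply: (Cm x' w') => //; first by apply: agree_le xx'; exact: leq_maxl.
  move=> k km; have : (k < count_ones b (maxn m n))%N.
    apply: leq_trans (leq_trans km mn) _.
    by apply: count_ones_le; exact: leq_maxr.
  move=> /count_ones_surj[i [ilt bi <-]].
  rewrite bw// (@count_ones_agree b b') ?bw' -?bb'//.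
  exact: agree_le (ltnW ilt) bb'.
Qed.

End BranchNormalForm.

(** * Runs over infinite concatenations *)

Section InfiniteConcatenation.
Variables (X : Type) (d : X) (U : nat -> seq X).

(** When no block is empty, the first [n.+1] blocks reach index [n], so the default [d] is never
    returned. *)
Definition iconcat (n : nat) : X := nth d (flatten (mkseq U n.+1)) n.

Definition offset (n : nat) : nat := size (flatten (mkseq U n)).

Lemma flatten_mkseqS (n : nat) :
  flatten (mkseq U n.+1) = flatten (mkseq U n) ++ U n.
Proof. by rewrite mkseqS flatten_rcons. Qed.

Lemma offsetS (n : nat) : offset n.+1 = offset n + size (U n).
Proof. by rewrite /offset flatten_mkseqS size_cat. Qed.

Hypothesis U_gt0 : forall n, (0 < size (U n))%N.

Lemma offset_ge (n : nat) : (n <= offset n)%N.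
Proof. by elim: n => // n; rewrite offsetS; have := U_gt0 n; lia. Qed.

Lemma offset_le (m n : nat) : (m <= n)%N -> (offset m <= offset n)%N.
Proof.
by elim: n => [|n IH]; rewrite leq_eqVlt => /predU1P[->//|//] /IH;
  rewrite offsetS; lia.
Qed.

Lemma nth_flatten_mkseq (m n k : nat) : (k < offset m)%N -> (m <= n)%N ->
  nth d (flatten (mkseq U n)) k = nth d (flatten (mkseq U m)) k.
Proof.
move=> km /subnKC <-; elim: (n - m) => [|i IH]; first by rewrite addn0.
rewrite addnS flatten_mkseqS nth_cat IH ifT//; apply: leq_trans km _.
exact: offset_le (leq_addr _ _).
Qed.

Lemma iconcatE (n i : nat) :
  (i < size (U n))%N -> iconcat (offset n + i) = nth d (U n) i.
Proof.
move=> iU; have lt : (offset n + i < offset n.+1)%N by rewrite offsetS; lia.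
have lt' : (offset n + i < offset (offset n + i).+1)%N by exact: offset_ge.
rewrite /iconcat; have [le|/ltnW le] := leqP n.+1 (offset n + i).+1.
  rewrite (nth_flatten_mkseq lt le) flatten_mkseqS nth_cat -/(offset n).
  by rewrite ifF; [congr nth|]; lia.
rewrite -(nth_flatten_mkseq lt' le) flatten_mkseqS nth_cat -/(offset n).
by rewrite ifF; [congr nth|]; lia.
Qed.

Lemma offset_decomp (k : nat) :
  exists n i, (i < size (U n))%N /\ k = offset n + i.
Proof.
elim: k => [|k [n [i [iU ->]]]]; first by exists 0, 0.
have [lt|ge] := ltnP i.+1 (size (U n)); first by exists n, i.+1; rewrite addnS.
by exists n.+1, 0; split=> //; rewrite offsetS; lia.
Qed.

End InfiniteConcatenation.

Lemma iconcat_agree (X : Type) (d : X) (U V : nat -> seq X) (n : nat) :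
  agree n U V -> agree n (iconcat d U) (iconcat d V).
Proof.
move=> UV i lt; rewrite /iconcat; congr (nth d (flatten _) i).
apply/eq_in_map => j; rewrite mem_iota => jlt; apply: UV; lia.
Qed.

(* [succ l t] lists the successors of the configuration [t] on reading [l]. *)
Section Post.
Variables (L T : eqType) (succ : L -> T -> seq T).

Fixpoint post (w : seq L) (t : T) : seq T :=
  if w is l :: w' then flatten [seq post w' u | u <- succ l t] else [:: t].

Lemma post_consP (l : L) (w : seq L) (t u : T) :
  reflect (exists2 v, v \in succ l t & u \in post w v) (u \in post (l :: w) t).
Proof. exact: flatten_mapP. Qed.

Lemma post_catP (w w' : seq L) (t u : T) :
  reflect (exists2 v, v \in post w t & u \in post w' v)
          (u \in post (w ++ w') t).
Proof.
apply: (iffP idP).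
- elim: w t => [|l w IH] t; first by exists t; rewrite ?mem_head.
  rewrite cat_cons => /post_consP[v vt /IH[v' vv' uv']].
  by exists v' => //; apply/post_consP; exists v.
- elim: w t => [|l w IH] t [v]; first by rewrite inE => /eqP->.
  by move=> /post_consP[v' v't vv'] uv; apply/post_consP; exists v' => //;
    apply: IH; exists v.
Qed.

Lemma post_run (d : L) (w : seq L) (r : nat -> T) (k : nat) :
  (forall i, (i < size w)%N -> r (k + i).+1 \in succ (nth d w i) (r (k + i))) ->
  r (k + size w) \in post w (r k).
Proof.
elim: w k => [|l w IH] k rP; first by rewrite addn0 mem_head.
apply/post_consP; exists (r k.+1); first by have := rP 0 isT; rewrite addn0.
rewrite -addSnnS; apply: IH => i lt.
by have := rP i.+1 lt; rewrite /= addnS addSn.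
Qed.

(** [s] omits the last configuration [u], which becomes the default of [nth]; such lists concatenate
    without repeating the junctions. *)
Lemma post_seq (d : L) (w : seq L) (t u : T) : u \in post w t ->
  exists2 s, size s = size w & nth u s 0 = t /\
    forall i, (i < size w)%N -> nth u s i.+1 \in succ (nth d w i) (nth u s i).
Proof.
elim: w t => [|l w IH] t; first by rewrite inE => /eqP->; exists [::].
move=> /post_consP[v vt /IH[s sw [s0 sP]]].
exists (t :: s); first by rewrite /= sw.
by split=> // -[_|i /sP//]; rewrite /= s0.
Qed.

Lemma iconcat_run (d : L) (U : nat -> seq L) (c : nat -> T) :
  (forall n, (0 < size (U n))%N) ->
  (forall n, c n.+1 \in post (U n) (c n)) ->
  exists2 r : nat -> T, forall n, r n.+1 \in succ (iconcat d U n) (r n) &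
    forall n, r (offset U n) = c n.
Proof.
move=> U_gt0 cP.
have /choice[s sP] n : exists s, size s = size (U n) /\
    nth (c n.+1) s 0 = c n /\ forall i, (i < size (U n))%N ->
      nth (c n.+1) s i.+1 \in succ (nth d (U n) i) (nth (c n.+1) s i).
  by have [s] := post_seq d (cP n); exists s.
have s_gt0 n : (0 < size (s n))%N by have [->] := sP n.
have offE n : offset s n = offset U n.
  by elim: n => // n IH; rewrite !offsetS IH; have [->] := sP n.
have rE n i : (i <= size (U n))%N ->
    iconcat (c 0) s (offset U n + i) = nth (c n.+1) (s n) i.
  rewrite leq_eqVlt -offE => /predU1P[->|lt].
    have [sU _] := sP n; have [_ [s0 _]] := sP n.+1.
    rewrite -sU -offsetS -[offset _ _]addn0 iconcatE//.
    by rewrite (set_nth_default (c n.+2))// s0 nth_default.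
  have [sU _] := sP n; rewrite iconcatE ?sU//.
  by apply: set_nth_default; rewrite sU.
exists (iconcat (c 0) s) => n; last first.
  by rewrite -[offset _ _]addn0 rE//; have [_ []] := sP n.
have [m [i [iU ->]]] := offset_decomp U_gt0 n.
by rewrite -addnS !rE// 1?ltnW// iconcatE//; have [_ [_]] := sP m; apply.
Qed.

End Post.

(** * The automaton *)

(* [inl None] ends a phase, [inl (Some None)] opens an option,
   [inl (Some (Some c))] closes an option marked [c], and [inr (i, s)]
   increments ([s]) or decrements ([~~ s]) counter [i], read as [0] or [1]. *)
Definition letter : finType := (option (option bool) + bool * bool)%type.

(* The mode is [None] while no option of the current phase is chosen,
   [Some false] while executing the chosen option and [Some true] afterwards.
   The flag holds the mark of the chosen option; in mode [None] it is set only
   just after the end of a phase. *)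
Definition state : finType := (option bool * bool)%type.

(** Guessing happens only at an option opener in mode [None]; the blocked cases force exactly one
    option to be executed in each completed phase. *)
Definition next_states (q : state) (l : letter) : seq state :=
  match q.1, l with
  | None, inl None => [::]
  | None, inl (Some None) => [:: (None, false); (Some false, false)]
  | None, _ => [:: (None, false)]
  | Some false, inl (Some (Some c)) => [:: (Some true, c)]
  | Some false, inl _ => [::]
  | Some false, inr _ => [:: (Some false, false)]
  | Some true, inl None => [:: (None, q.2)]
  | Some true, _ => [:: (Some true, q.2)]
  end.

Definition effect (q : state) (l : letter) : {ffun 'I_4 -> int} :=
  [ffun m : 'I_4 =>
    (match q.1, l with
     | Some false, inr (i, s) =>
       if m == i :> nat then if s then 1 else -1 else 0
     | _, _ => 0
     end)%R : int].

Definition phase_trans (q : state) (l : letter) (i : {ffun 'I_4 -> bool})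
    (q' : state) (j : {ffun 'I_4 -> int}) : bool :=
  [&& q' \in next_states q l, j == effect q l &
      [forall m, i m || (j m != (-1)%R)]].

Lemma phase_trans_incr q l i q' j : phase_trans q l i q' j ->
  forall m, j m \in [:: 0; 1; -1]%R.
Proof.
move=> /and3P[_ /eqP-> _] m; rewrite ffunE.
by case: q l => [[[]|] f] [[[]|]|[i' []]] //=; case: ifP.
Qed.

Lemma phase_trans_zero q l i q' j : phase_trans q l i q' j ->
  forall m, i m = false -> j m \in [:: 0; 1]%R.
Proof.
move=> tr m im; have := phase_trans_incr tr m.
have /and3P[_ _ /forallP/(_ m)] := tr.
by rewrite im !inE /= => /negbTE ->; rewrite orbF.
Qed.

Lemma phase_trans_blind q l i q' j : phase_trans q l i q' j ->
  forall m, i m = false ->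
  phase_trans q l [ffun n => if n == m then true else i n] q' j.
Proof.
move=> /and3P[qn je /forallP iP] m im; apply/and3P; split=> //.
by apply/forallP => n; rewrite ffunE; case: eqP => //= _; exact: iP.
Qed.

Definition phase_automaton : buchi_bc_automaton 4 letter :=
  BuchiBCAutomaton (buchi_machine := BCMachine (None, false) phase_trans_incr
    phase_trans_zero phase_trans_blind) [set (None, true)].

Definition counters (c : nat * nat) : {ffun 'I_4 -> nat} :=
  [ffun m : 'I_4 => match val m with 0 => c.1 | 1 => c.2 | _ => 0 end].

Definition config_of (t : state * (nat * nat)) : bc_config phase_automaton :=
  (t.1, counters t.2).

Definition update (q : state) (l : letter) (c : nat * nat) : seq (nat * nat) :=
  match q.1, l with
  | Some false, inr (false, true) => [:: (c.1.+1, c.2)]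
  | Some false, inr (true, true) => [:: (c.1, c.2.+1)]
  | Some false, inr (false, false) =>
    if c.1 is a.+1 then [:: (a, c.2)] else [::]
  | Some false, inr (true, false) =>
    if c.2 is b.+1 then [:: (c.1, b)] else [::]
  | _, _ => [:: c]
  end.

Definition succ (l : letter) (t : state * (nat * nat)) :
    seq (state * (nat * nat)) :=
  [seq (q, c) | q <- next_states t.1 l, c <- update t.1 l t.2].

(** Since [c'] has natural values, the integer equation alone forbids decrementing a zero counter,
    the case where [update] is empty. *)
Lemma update_effect (q : state) (l : letter) (c : nat * nat)
    (c' : {ffun 'I_4 -> nat}) :
  (forall m, (c' m)%:Z = (counters c m)%:Z + effect q l m)%R <->
  exists2 d, d \in update q l c & c' = counters d.
Proof.
case: c => a b; split=> [cP|[d]].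
- have := cP (@Ordinal 4 0 isT); have := cP (@Ordinal 4 1 isT).
  have := cP (@Ordinal 4 2 isT); have := cP (@Ordinal 4 3 isT).
  have cE d : c' (@Ordinal 4 0 isT) = d.1 -> c' (@Ordinal 4 1 isT) = d.2 ->
      c' (@Ordinal 4 2 isT) = 0 -> c' (@Ordinal 4 3 isT) = 0 -> c' = counters d.
    move=> c0 c1 c2 c3; apply/ffunP => -[[|[|[|[|//]]]] i]; rewrite ffunE /=;
      [apply: etrans c0|apply: etrans c1|apply: etrans c2|apply: etrans c3];
      by congr (c' _); exact: val_inj.
  rewrite !ffunE /= /update.
  case: q l {cP} => [[[]|] f] [o|[[] []]] /= c3 c2 c1 c0;
    do ?[by exists (a, b); [exact: mem_head|apply: cE => /=; lia]
        |by exists (a.+1, b); [exact: mem_head|apply: cE => /=; lia]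
        |by exists (a, b.+1); [exact: mem_head|apply: cE => /=; lia]].
  + case: b c1 => [|b] c1; first by lia.
    by exists (a, b); [exact: mem_head|apply: cE => /=; lia].
  + case: a c0 => [|a] c0; first by lia.
    by exists (a, b); [exact: mem_head|apply: cE => /=; lia].
- move=> + -> m; rewrite !ffunE /update.
  case: q l a b => [[[]|] f] [o|[[] []]] [|a] [|b] //=; rewrite inE => /eqP ->;
    by case: m => -[|[|[|[|//]]]] i /=; lia.
Qed.

Lemma bc_step_config (l : letter) (t : state * (nat * nat))
    (r : bc_config phase_automaton) :
  bc_step l (config_of t) r <-> exists2 u, u \in succ l t & r = config_of u.
Proof.
case: t r => q c [q' c'].
split=> [[j [/and3P[/= qn /eqP-> _] /update_effect]]|].
- by move=> [d du ->]; exists (q', d); first exact: allpairs_f.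
- move=> [u /allpairsP[[q'' d] [/= qn dc ->]] [-> c'E]]; exists (effect q l).
  have cP : (forall m, (c' m)%:Z = (counters c m)%:Z + effect q l m)%R.
    by apply/update_effect; exists d.
  split=> //; apply/and3P; split=> //; apply/forallP => m.
  rewrite ffunE -implyNb -eqn0Ngt; apply/implyP => /eqP c0; apply/eqP => e.
  by have := cP m; rewrite e c0; lia.
Qed.

Lemma config_of_inj : injective config_of.
Proof.
move=> [q [a b]] [q' [a' b']] [-> /ffunP cE].
have := cE (@Ordinal 4 0 isT); have := cE (@Ordinal 4 1 isT).
by rewrite !ffunE /= => -> ->.
Qed.

Lemma phase_language (s : omega_words letter) :
  buchi_language phase_automaton s <->
  exists t : nat -> state * (nat * nat),
    [/\ t 0 = ((None, false), (0, 0)),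
        forall n, t n.+1 \in succ (s n) (t n) &
        infinitely_often (fun n => (t n).1 = (None, true))].
Proof.
have counters0 : [ffun=> 0] = counters (0, 0).
  by apply/ffunP => m; rewrite !ffunE; case: (val m) => [|[]].
split=> [[r [r0 rS] [q]]|[t [t0 tS tF]]].
- rewrite inE => /eqP -> rF.
  have /choice[t tE] n : exists t, r n = config_of t.
    elim: n => [|n [t rn]].
      by exists ((None, false), (0, 0)); rewrite r0 counters0.
    by have := rS n; rewrite rn => /bc_step_config[u _ ->]; exists u.
  exists t; split=> [|n|n].
  + by apply: config_of_inj; rewrite -tE r0 counters0.
  + have := rS n; rewrite tE => /bc_step_config[u ut].
    by rewrite tE => /config_of_inj ->.
  + by have [p np rp] := rF n; exists p; rewrite // -rp tE.
- exists (config_of \o t); first split.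
  + by rewrite /= t0 counters0.
  + by move=> n; apply/bc_step_config; exists (t n.+1).
  + by exists (None, true); rewrite ?inE.
Qed.

(** * Words coding layered graphs *)

Definition vmax (n : nat) : nat := (2 ^ n).-1.

(* Keeping [v] in one counter and its complement in the other makes the test
   "the current vertex is [v]" exact: it amounts to two decrements. *)
Definition vertex (n v : nat) : nat * nat := (v, vmax n - v).

(** The decrements succeed from [vertex n a] only if [v = a], and then leave both counters at zero;
    the increments load [vertex n.+1 (v.*2 + c)] from there. *)
Definition option_body (n v : nat) (c : bool) : seq letter :=
  nseq v (inr (false, false)) ++ nseq (vmax n - v) (inr (true, false)) ++
  nseq (v.*2 + c) (inr (false, true)) ++
  nseq (vmax n.+1 - (v.*2 + c)) (inr (true, true)) ++ [:: inl (Some (Some c))].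

Definition option_word (n : nat) (o : nat * bool) : seq letter :=
  inl (Some None) :: option_body n o.1 o.2.

Definition options_word (n : nat) (os : seq (nat * bool)) : seq letter :=
  flatten [seq option_word n o | o <- os].

Definition phase_word (edge : nat -> nat -> bool -> bool) (n : nat) :
    seq letter :=
  options_word n [seq o <- [seq (v, c) | v <- iota 0 (2 ^ n),
                                        c <- [:: false; true]]
                 | edge n o.1 o.2] ++ [:: inl None].

Definition idle (l : letter) : bool :=
  (l != inl None) && (l != inl (Some None)).

Lemma idle_option_body (n v : nat) (c : bool) : all idle (option_body n v c).
Proof. by rewrite !all_cat !all_nseq /= !orbT. Qed.

Lemma post_skip (w : seq letter) (c : nat * nat) :
  all idle w -> post succ w ((None, false), c) = [:: ((None, false), c)].
Proof. by elim: w => //= -[[[c'|]|]|[i s]] w //= IH /IH ->. Qed.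

Lemma post_done (w : seq letter) (f : bool) (c : nat * nat) :
  inl None \notin w ->
  post succ w ((Some true, f), c) = [:: ((Some true, f), c)].
Proof.
by elim: w => //= -[[[c'|]|]|[i s]] w IH; rewrite inE//= => /IH ->.
Qed.

Lemma post_inc (i : bool) (n : nat) (w : seq letter) (a b : nat) :
  post succ (nseq n (inr (i, true)) ++ w) ((Some false, false), (a, b)) =
  post succ w ((Some false, false), if i then (a, b + n) else (a + n, b)).
Proof.
elim: n a b => [|n IH] a b; first by rewrite !addn0; case: i.
by case: i IH => /= IH; rewrite cats0 IH addSnnS.
Qed.

Lemma post_dec (i : bool) (n : nat) (w : seq letter) (a b : nat) :
  post succ (nseq n (inr (i, false)) ++ w) ((Some false, false), (a, b)) =
  if (n <= if i then b else a)%N then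
    post succ w ((Some false, false), if i then (a, b - n) else (a - n, b))
  else [::].
Proof.
elim: n a b => [|n IH] a b; first by rewrite !subn0; case: i.
by case: i IH => /= IH; [case: b => [|b]|case: a => [|a]]; rewrite //= cats0 IH.
Qed.

Lemma post_option (n a v : nat) (c f : bool) :
  (a <= vmax n)%N -> (v <= vmax n)%N ->
  post succ (option_word n (v, c)) ((None, f), vertex n a) =
  ((None, false), vertex n a) ::
  if v == a then [:: ((Some true, c), vertex n.+1 (a.*2 + c))] else [::].
Proof.
move=> an vn; rewrite /= post_skip ?idle_option_body//= cats0; congr cons.
rewrite /option_body /vertex !post_dec /= !post_inc /=.
(* If [v] differs from [a], one of [v <= a] and [vmax n - v <= vmax n - a] fails. *)
case: eqP => [->|va]; last by do 2!case: ifP => //; lia.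
rewrite !leqnn; congr [:: (_, (_, _))]; lia.
Qed.

Lemma inl_None_options (n : nat) (os : seq (nat * bool)) :
  inl None \notin options_word n os.
Proof.
apply/flatten_mapP => -[[v c] _]; rewrite inE /=.
by move=> /(allP (idle_option_body n v c)).
Qed.

Lemma post_options (n a : nat) (f : bool) (os : seq (nat * bool)) u :
  (a <= vmax n)%N -> {in os, forall o, (o.1 <= vmax n)%N} ->
  u \in post succ (options_word n os) ((None, f), vertex n a) ->
  (exists f', u = ((None, f'), vertex n a)) \/
  (exists2 c, (a, c) \in os & u = ((Some true, c), vertex n.+1 (a.*2 + c))).
Proof.
move=> an; elim: os f => [|[v c] os IH] f osn.
  by rewrite inE => /eqP ->; left; exists f.
have vn : (v <= vmax n)%N by apply: (osn (v, c)); exact: mem_head.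
have {}osn : {in os, forall o, (o.1 <= vmax n)%N}.
  by move=> o oos; apply: osn; rewrite inE oos orbT.
move=> /post_catP[t]; rewrite post_option// inE => /predU1P[->|].
  move=> /(IH _ osn)[[f' ->]|[c' c'os ->]]; first by left; exists f'.
  by right; exists c'; rewrite // inE c'os orbT.
case: eqP => // ->; rewrite inE => /eqP ->.
rewrite -/(options_word n os) post_done ?inl_None_options// inE => /eqP ->.
by right; exists c; rewrite ?mem_head.
Qed.

Lemma mem_post_options (n a : nat) (c f : bool) (os : seq (nat * bool)) :
  (a <= vmax n)%N -> {in os, forall o, (o.1 <= vmax n)%N} -> (a, c) \in os ->
  ((Some true, c), vertex n.+1 (a.*2 + c)) \in
    post succ (options_word n os) ((None, f), vertex n a).
Proof.
move=> an; elim: os f => [|[v c'] os IH] f osn; first by [].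

have vn : (v <= vmax n)%N by apply: (osn (v, c')); exact: mem_head.
have {}osn : {in os, forall o, (o.1 <= vmax n)%N}.
  by move=> o oos; apply: osn; rewrite inE oos orbT.
rewrite inE => /predU1P[[<- <-]|acos]; apply/post_catP.
  exists ((Some true, c), vertex n.+1 (a.*2 + c)).
    by rewrite post_option// eqxx !inE eqxx orbT.
  by rewrite -/(options_word n os) post_done ?inl_None_options// mem_head.
exists ((None, false), vertex n a); last exact: IH.
by rewrite post_option// mem_head.
Qed.

Section PhaseWords.
Variable edge : nat -> nat -> bool -> bool.

Lemma post_phase (n a : nat) (f : bool) u : (a <= vmax n)%N ->
  u \in post succ (phase_word edge n) ((None, f), vertex n a) <->
  exists2 c, edge n a c & u = ((None, c), vertex n.+1 (a.*2 + c)).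
Proof.
move=> an; rewrite /phase_word; set os := seq.filter _ _.
have osE v c : ((v, c) \in os) = (v <= vmax n)%N && edge n v c.
  rewrite mem_filter andbC; congr (_ && _).
  apply/allpairsP/idP => [[[v' c'] /= [+ _ [-> _]]]|vn].
    by rewrite mem_iota /vmax; lia.
  exists (v, c); split=> //=; last by case: c.
  by rewrite mem_iota; move: vn; rewrite /vmax; have := expn_gt0 2 n; lia.
have osn : {in os, forall o, (o.1 <= vmax n)%N}.
  by move=> [v c]; rewrite osE => /andP[].
split.
- move=> /post_catP[t /(post_options an osn)[[f' ->]|[c]]] //.
  rewrite osE => /andP[_ e] -> /=; rewrite inE => /eqP ->.
  by exists c.
- move=> [c e ->]; apply/post_catP.
  exists ((Some true, c), vertex n.+1 (a.*2 + c)); last exact: mem_head.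
  by apply: mem_post_options => //; rewrite osE an.
Qed.

Lemma size_phase_word_gt0 (n : nat) : (0 < size (phase_word edge n))%N.
Proof. by rewrite size_cat addn1. Qed.

Lemma nth_phase_word (d : letter) (n i : nat) :
  (i < size (phase_word edge n))%N -> nth d (phase_word edge n) i = inl None ->
  i.+1 = size (phase_word edge n).
Proof.
rewrite size_cat addn1 ltnS leq_eqVlt => /predU1P[->//|lt].
rewrite nth_cat lt => e; have := inl_None_options n
  [seq o <- [seq (v, c) | v <- iota 0 (2 ^ n), c <- [:: false; true]]
  | edge n o.1 o.2].
by rewrite -e mem_nth.
Qed.

Definition graph_word : omega_words letter :=
  iconcat (inl None) (phase_word edge).

Lemma graph_word_language :
  buchi_language phase_automaton graph_word <->
  exists2 b : nat -> bool, infinitely_often b &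
    forall n, edge n (bits_val b n) (b n).
Proof.
have le_vmax b n : (bits_val b n <= vmax n)%N.
  by have := bits_val_lt b n; rewrite /vmax; lia.
have U_gt0 := size_phase_word_gt0.
rewrite phase_language; split=> [[t [t0 tS tF]]|[b ib be]].
- pose c n := t (offset (phase_word edge) n).
  have cS n : c n.+1 \in post succ (phase_word edge n) (c n).
    rewrite /c offsetS; apply: (@post_run _ _ _ (inl None)) => i lt.
    by rewrite -(iconcatE (inl None) U_gt0 lt); exact: tS.
  (* The flag at the end of phase [n] is the mark of the edge taken there. *)
  pose b n := (c n.+1).1.2.
  have cE n : exists f, c n = ((None, f), vertex n (bits_val b n)).
    elim: n => [|n [f cn]]; first by exists false; rewrite /c t0.
    have := cS n; rewrite cn => /(post_phase _ _ (le_vmax b n))[c' _ cn1].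
    by exists c'; rewrite cn1 /= (_ : b n = c')// /b cn1.
  exists b => n.
  (* The final state is entered only on [inl None], the last letter of a phase. The successor makes
     the letter [k] read just before the visit lie in a phase [j >= n]. *)
  + have [[|k] nk tk] := tF (offset (phase_word edge) n).+1; first by [].
    have := tS k; rewrite /graph_word.
    have [j [i [lt kE]]] := offset_decomp U_gt0 k.
    rewrite kE (iconcatE _ U_gt0 lt) -kE => /allpairsP[[q d] /= [qn _ tkE]].
    have : nth (inl None) (phase_word edge j) i = inl None.
      move: qn; have -> : q = (None, true) by rewrite -tk tkE.
      case: (nth _ _ _) => [[[c'|]|]|[i' s]] //;
        by case: (t k).1 => [[[]|] f].
    move=> /(nth_phase_word lt) iE; exists j.
      rewrite leqNgt; apply/negP => jn.
      have := offset_le (phase_word edge) jn; rewrite offsetS.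
      by move: nk; rewrite kE; lia.
    by rewrite /b /c offsetS -iE addnS -kE tk.
  + have [f cn] := cE n; have := cS n.
    rewrite cn => /(post_phase _ _ (le_vmax b n))[c' e cn1].
    by rewrite {2}/b cn1.
- pose c n : state * (nat * nat) :=
    ((None, if n is k.+1 then b k else false), vertex n (bits_val b n)).
  have cS n : c n.+1 \in post succ (phase_word edge n) (c n).
    by apply/post_phase => //; exists (b n).
  have [t tS tE] := iconcat_run (inl None) U_gt0 cS.
  exists t; split=> [|//|n].
    by rewrite -[0]/(offset (phase_word edge) 0) tE.
  have [p np bp] := ib n; exists (offset (phase_word edge) p.+1).
    by have := offset_ge U_gt0 p.+1; lia.
  by rewrite tE /= bp.
Qed.

End PhaseWords.

(** * Completeness *)

Lemma Sigma11_reducible (Y : finType) (E : set (omega_words Y)) :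
  Sigma11 E -> exists2 f : omega_words Y -> omega_words letter,
    continuous f & E = f @^-1` buchi_language phase_automaton.
Proof.
move=> /Sigma11_baire[C cC EC].
exists (fun x => graph_word (branch_edge C x)).
(* The first [m] letters of the image depend on the first [m] phases, and phase [n] on the first [n]
   letters of [x]. *)
- apply/continuous_omega => x m; exists m => y xy; apply: iconcat_agree => n nm.
  by rewrite /phase_word (branch_edge_agree C (agree_le (ltnW nm) xy)).
- apply/seteqP; split=> x /=;
    by rewrite EC (branch_normal_form x cC) graph_word_language.
Qed.

(** * Continuous preimages of automaton languages are analytic *)

Lemma Borel_bigcap_open (T : topologicalType) (O : nat -> set T) :
  (forall n, open (O n)) -> Borel (\bigcap_n O n).
Proof.
move=> oO; have [_ BC BU] : sigma_algebra setT (@Borel T).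
  exact: smallest_sigma_algebra.
rewrite -[bigcap _ _]setCK setC_bigcap -setTD; apply: (BC); apply: (BU) => n.
by rewrite -setTD; apply: BC; exact: sub_gen_smallest.
Qed.

Section RunCoding.
Variables (k : nat) (A : finType) (M : buchi_bc_automaton k A).

(* The [n]-th letter of the code of a run holds the state reached after [n.+1]
   steps, for each counter whether step [n] increments or decrements it, and a
   final state, the one in the first letter being visited infinitely often. *)
Definition run_letter : finType :=
  (bc_state M * {ffun 'I_k -> bool * bool} * bc_state M)%type.

(** Truncated subtraction makes every word decode to some sequence of configurations; whether it is
    a run is left to [accepting_run]. *)
Fixpoint decode_run (z : nat -> run_letter) (n : nat) : bc_config M :=
  if n is p.+1 then
    ((z p).1.1, [ffun m => (decode_run z p).2 m + ((z p).1.2 m).1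
                            - ((z p).1.2 m).2])
  else (bc_init M, [ffun=> 0]).

Lemma decode_run_agree (n : nat) (z z' : nat -> run_letter) :
  agree n z z' -> decode_run z n = decode_run z' n.
Proof.
elim: n => //= n IH zz'; rewrite (zz' n)// IH// => i /ltnW; exact: zz'.
Qed.

Lemma decode_run_surj (s : omega_words A) (r : nat -> bc_config M)
    (q : bc_state M) :
  bc_run s r -> exists2 z, decode_run z =1 r & (z 0).2 = q.
Proof.
move=> [r0 rS].
exists (fun n => ((r n.+1).1,
  [ffun m => ((r n).2 m < (r n.+1).2 m, (r n.+1).2 m < (r n).2 m)%N], q)) => //.
elim=> [//|n IH] /=; rewrite [r n.+1]surjective_pairing; congr (_, _).
apply/ffunP => m; rewrite ffunE IH ffunE /=.
have [j [/bc_trans_incr/(_ m) jm /(_ m)]] := rS n.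
by move: jm; rewrite !inE => /or3P[] /eqP ->; lia.
Qed.

(** For each [n] this depends on finitely many letters once the visit [i] is known, hence is open;
    the intersection over [n] is the G-delta condition. *)
Definition accepting_run (s : omega_words A) (z : omega_words run_letter)
    (n : nat) : Prop :=
  [/\ bc_step (s n) (decode_run z n) (decode_run z n.+1),
      (z 0).2 \in buchi_final M &
      exists2 i, (n <= i)%N & (decode_run z i).1 = (z 0).2].

Lemma buchi_languageE (s : omega_words A) :
  buchi_language M s <->
  exists z : omega_words run_letter, forall n, accepting_run s z n.
Proof.
split=> [[r sr [q qF rq]]|[z zP]].
- have [z /funext zr z0] := decode_run_surj q sr.
  exists z => n; rewrite /accepting_run zr z0; split=> //.
  by case: sr => _; exact.
- exists (decode_run z); first by split=> // n; have [] := zP n.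
  exists (z 0).2; first by have [] := zP 0.
  by move=> n; have [] := zP n.
Qed.

Lemma preimage_buchi_Sigma11 (Y : finType)
    (f : omega_words Y -> omega_words A) :
  continuous f -> Sigma11 (f @^-1` buchi_language M).
Proof.
move=> /continuous_omega cf; exists run_letter.
pose O n := [set p : omega_words Y * omega_words run_letter |
  accepting_run (f p.1) p.2 n].
exists (\bigcap_n O n); split.
- apply: Borel_bigcap_open => n; apply/open_omega2 => p [st qF [i ni pi]].
  have [l fl] := cf p.1 n.+1.
  (* As [n <= i], the first [i.+1] letters of the code fix letter 0, step [n] and the visit at [i];
     [l] fixes letter [n] of the image. *)
  exists (l + i.+1) => q [pq1 pq2].
  have pq j : (j <= i.+1)%N -> decode_run p.2 j = decode_run q.2 j.
    by move=> ji; apply: decode_run_agree; apply: agree_le pq2; lia.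
  have fpq : f p.1 n = f q.1 n.
    by apply: (fl q.1) => //; apply: agree_le pq1; exact: leq_addr.
  have pq0 : p.2 0 = q.2 0 by apply: pq2; lia.
  split; rewrite -?fpq -?pq0 //; last by exists i; rewrite // -pq.
  by rewrite -(pq n.+1)// -(pq n)// leqW.
- apply/seteqP; split=> x /=.
  + by move=> /buchi_languageE[z zP]; exists (x, z) => // n _; exact: zP.
  + move=> [[y z] zP /= <-]; apply/buchi_languageE.
    by exists z => n; exact: (zP n I).
Qed.

End RunCoding.

Theorem corollary4p16 :
  exists (A : finType) (F : set (omega_words A)),
    rBCL_omega 4 F /\ Sigma11_complete F.
Proof.
exists letter, (buchi_language phase_automaton); split.
  by exists phase_automaton.
move=> Y E; split=> [|[f cf ->]]; first exact: Sigma11_reducible.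
exact: preimage_buchi_Sigma11.
Qed.
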